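(* Let $n\ge1$ and let $\varphi:\mathbb{R}^+\to\mathbb{R}^+\cup\{0\}$ be measurable with $\omega_n\int_0^\infty\rho^{n-1}\varphi(\rho)\,d\rho=1$, where $\omega_n$ is the surface measure of the unit sphere in $\mathbb{R}^n$. For $j=1,2,\dots$ let $\varepsilon_j$ be a positive random variable and $y_j$ an $\mathbb{R}^n$-valued random vector on a probability space $(\Omega,\mathscr{F},\mathscr{P})$. Assume that the joint distribution $\Pi_j$ of $(\varepsilon_j,y_j)$ converges vaguely to $\delta_{(0,\mathbf{0})}$, the Dirac unit mass at $(0,\mathbf{0})\in\mathbb{R}^{n+1}$. Let $g$ be a continuous and bounded function defined on $\mathbb{R}^n$. Then $m_jg(x)\to g(x)$ as $j\to\infty$ for every $x\in\mathbb{R}^n$.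
   Context: $\mathbb{R}^+=\{t\in\mathbb{R}:t>0\}$. $\mathscr{E}$ denotes expectation. $\Pi_j(E)=\mathscr{P}(\{\omega:(\varepsilon_j(\omega),y_j(\omega))\in E\})$ for Borel $E\subseteq\mathbb{R}^{n+1}$. Vague convergence of $\Pi_j$ to $\delta_{(0,\mathbf{0})}$ means $\int h\,d\Pi_j\to h(0,\mathbf{0})$ for every bounded continuous $h:\mathbb{R}^{n+1}\to\mathbb{R}$. The mean operators are $$m_j(f)(x)=\mathscr{E}\left[\frac{1}{\varepsilon_j^n(\omega)}\int_{z\in\mathbb{R}^n}\varphi\left(\frac{|x-z-y_j(\omega)|}{\varepsilon_j(\omega)}\right)f(z)\,dz\right]=\mathscr{E}\left[\int_{z\in\mathbb{R}^n}\varphi(|z|)f(x-y_j(\omega)-\varepsilon_j(\omega)z)\,dz\right].$$ *)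

(* Defs.v *)
From HB Require Import structures.
From mathcomp Require Import all_boot all_order all_algebra.
From mathcomp Require Import all_classical all_reals all_analysis.
From mathcomp Require Import measurable_realfun.

Set Implicit Arguments.
Unset Strict Implicit.
Unset Printing Implicit Defensive.
Import Order.TTheory GRing.Theory Num.Theory.
Import numFieldNormedType.Exports.

Local Open Scope classical_set_scope.
Local Open Scope ring_scope.

(* R^n is ['rV[R]_n]; its library topology comes from the sup norm, hence is the
   usual one, but its library norm [`|v|] is not the Euclidean norm. *)
Definition enorm (R : realType) (n : nat) (v : 'rV[R]_n) : R :=
  Num.sqrt (\sum_(i < n) v ord0 i ^+ 2).

HB.instance Definition _ (R : realType) (n : nat) := @isMeasurable.Build
  (sigma_display (@open 'rV[R]_n)) 'rV[R]_n <<s @open 'rV[R]_n >>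
  (@sigma_algebra0 _ setT _) (@sigma_algebraC _ _)
  (@sigma_algebra_bigcup _ setT _).

Section borel_rV.
Context {R : realType} {n : nat}.

Definition box_rat (p : 'rV[rat]_n * nat) : set 'rV[R]_n :=
  [set v | forall i, ball (ratr (p.1 ord0 i) : R) p.2.+1%:R^-1 (v ord0 i)].

Lemma open_bigcup_box_rat (U : set 'rV[R]_n) : open U ->
  U = \bigcup_p (if `[< box_rat p `<=` U >] then box_rat p else set0).
Proof.
move=> oU; apply/seteqP; split => [x Ux|x [p _]]; last first.
  by case: asboolP => // pU /pU.
have /nbhs_ballP[e /= e0 eU] : nbhs x U by exact: open_nbhs_nbhs.
have [k ke] : exists k : nat, k.+1%:R^-1 < e / 2.
  have e20 : 0 < e / 2 by rewrite divr_gt0.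
  exists (Num.bound (e / 2)^-1).
  rewrite invf_plt ?posrE//; apply: (lt_le_trans (archi_boundP _)).
    by rewrite invr_ge0 ltW.
  by rewrite ler_nat.
have hq i : exists q : rat, ball (x ord0 i) k.+1%:R^-1 (ratr q : R).
  have /rat_in_itvoo[q] : x ord0 i - k.+1%:R^-1 < x ord0 i + k.+1%:R^-1.
    by rewrite ltrBlDr -addrA ltrDl addr_gt0// invr_gt0.
  rewrite in_itv/= => /andP[h1 h2]; exists q.
  by rewrite /ball/= ltr_distlC h1 h2.
pose q : 'rV[rat]_n := \row_i projT1 (cid (hq i)).
exists (q, k) => //; case: asboolP => [_ i|[]] /=.
  by rewrite /q mxE; case: cid => r /= hr; exact: ball_sym.
move=> v hv; apply: eU; split => // i j; rewrite !ord1.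
have := hv j; rewrite /q mxE; case: cid => r /= hr hv'.
have := ball_triangle hr hv'; apply: le_ball.
by rewrite (splitr e) lerD// ltW.
Qed.

Lemma measurable_coord (i : 'I_n) :
  measurable_fun setT (fun v : 'rV[R]_n => v ord0 i).
Proof.
apply: (measurability _ (RGenOInfty.measurableE R)) => // _ [_ [a ->] <-].
rewrite setTI; apply: sub_sigma_algebra.
by apply: open_comp => [v _|]; [exact: coord_continuous|exact: interval_open].
Qed.

Lemma measurable_fun_rV d (T : measurableType d) (f : T -> 'rV[R]_n) :
  (forall i, measurable_fun setT (fun t => f t ord0 i)) ->
  measurable_fun setT f.
Proof.
move=> mf; apply: (@measurability _ _ _ _ _ _ (@open 'rV[R]_n)) => //.
move=> _ [U oU <-]; rewrite setTI (open_bigcup_box_rat oU) preimage_bigcup.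
apply: countable_bigcupT_measurable => [|p]; first exact: countableP.
case: asboolP => _; last by rewrite preimage_set0.
rewrite (_ : _ @^-1` _ = \bigcap_(i in [set: 'I_n])
    ((fun t => f t ord0 i) @^-1` ball (ratr (p.1 ord0 i) : R) p.2.+1%:R^-1)).
  apply: fin_bigcap_measurable => [|i _]; first exact: finite_finset.
  by rewrite -[X in measurable X]setTI; apply: mf => //; exact: measurable_ball.
by apply/seteqP; split => [t ht i _|t ht i]; [exact: ht|exact: ht].
Qed.

End borel_rV.

Section lebesgue_measure_rV.
Context {R : realType}.

Definition cons_rV n (p : 'rV[R]_n * R) : 'rV[R]_n.+1 := row_mx p.2%:M p.1.

Lemma measurable_cons_rV n : measurable_fun setT (@cons_rV n).
Proof.
apply: measurable_fun_rV => i; case: (@split_ordP 1 n i) => j ->.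
  rewrite (_ : (fun _ => _) = snd)//.
  by apply/funext => p; rewrite (@row_mxEl _ 1 1 n) mxE !ord1.
rewrite (_ : (fun _ => _) = (fun v : 'rV[R]_n => v ord0 j) \o fst).
  exact: (measurableT_comp (measurable_coord j) measurable_fst).
by apply/funext => p; rewrite (@row_mxEr _ 1 1 n).
Qed.

Section cons_measure.
Context {n : nat} (mu : {measure set 'rV[R]_n -> \bar R}).

Definition cons_measure : set 'rV[R]_n.+1 -> \bar R :=
  pushforward (mu \x @lebesgue_measure R)%E (@cons_rV n).

Let measurable_cons := @measurable_cons_rV n.

Let cons_measure0 : cons_measure set0 = 0%E.
Proof. exact: measure0. Qed.

Let cons_measure_ge0 A : (0 <= cons_measure A)%E.
Proof. exact: measure_ge0. Qed.

Let cons_measure_sigma_additive : semi_sigma_additive cons_measure.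
Proof. exact: measure_semi_sigma_additive. Qed.

HB.instance Definition _ := isMeasure.Build _ _ _ cons_measure
  cons_measure0 cons_measure_ge0 cons_measure_sigma_additive.

End cons_measure.

(* on the Borel sets only *)
Fixpoint lebesgue_measure_rV n : {measure set 'rV[R]_n -> \bar R} :=
  match n with
  | 0 => \d_(0 : 'rV[R]_0)
  | m.+1 => cons_measure (lebesgue_measure_rV m)
  end.

Lemma lebesgue_measure_rV_box n (A : 'I_n -> set R) :
  (forall i, measurable (A i)) ->
  lebesgue_measure_rV n [set v | forall i, A i (v ord0 i)] =
  (\prod_(i < n) @lebesgue_measure R (A i))%E.
Proof.
elim: n A => [|n IHn] A mA.
  by rewrite big_ord0 /= diracE mem_set// => -[].
rewrite big_ord_recl /= /cons_measure /pushforward.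
pose B := [set v : 'rV[R]_n | forall i, A (lift ord0 i) (v ord0 i)].
have mB : measurable B.
  rewrite (_ : B = \bigcap_(i in [set: 'I_n])
      ((fun v : 'rV[R]_n => v ord0 i) @^-1` A (lift ord0 i))).
    apply: fin_bigcap_measurable => [|i _]; first exact: finite_finset.
    by rewrite -[X in measurable X]setTI; exact: measurable_coord.
  by apply/seteqP; split => [t ht i _|t ht i]; exact: ht.
rewrite (_ : _ @^-1` _ = B `*` A ord0).
  rewrite product_measure1E ?(IHn (fun i => A (lift ord0 i)))//.
    by rewrite muleC.
  exact: mA.
have cons0 p : @cons_rV n p ord0 ord0 = p.2.
  rewrite (_ : ord0 = lshift n (@ord0 0)); last exact/val_inj.
  by rewrite [LHS](@row_mxEl _ 1 1 n) mxE !ord1.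
have consS p i : @cons_rV n p ord0 (lift ord0 i) = p.1 ord0 i.
  rewrite (_ : lift ord0 i = rshift 1 i); last exact/val_inj.
  by rewrite [LHS](@row_mxEr _ 1 1 n).
apply/seteqP; split => [p /= hp|p /= [pB p0] i].
  by split=> [i|]; [rewrite -consS|rewrite -cons0]; exact: hp.
have [j ->|->] := unliftP ord0 i; last by rewrite cons0.
by rewrite consS; exact: pB.
Qed.

End lebesgue_measure_rV.

(* on all the Lebesgue measurable sets *)
Definition completed_lebesgue_measure_rV (R : realType) (n : nat) :=
  @completed_measure_extension _ _ _ (@lebesgue_measure_rV R n).

HB.instance Definition _ (R : realType) (n : nat) :=
  Measure.on (@completed_lebesgue_measure_rV R n).

(* Lebesgue (not only Borel) measurability: the sigma-algebra on the source is
   the domain of [completed_lebesgue_measure]. *)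
Definition lebesgue_measurable_fun (R : realType) (D : set R) (f : R -> R) :=
  @measurable_fun _ _ (caratheodory_type (@wlength R idfun)^*%mu) R D f.

(* The surface measure on the unit sphere, through the cones
   { r u | 0 < r < 1, u \in A } over the subsets A of the sphere *)
Definition surface_measure (R : realType) (n : nat) (A : set 'rV[R]_n) :
    \bar R :=
  let cone : set 'rV[R]_n := [set r *: u | r in `]0, 1[ & u in A] in
  (n%:R%:E * completed_lebesgue_measure_rV cone)%E.

Definition sphere_area (R : realType) (n : nat) : \bar R :=
  surface_measure [set u : 'rV[R]_n | enorm u = 1].

Section mean_operator.
Context d (T : measurableType d) (R : realType) (P : probability T R).
Context {n : nat}.

Definition joint_rV (eps : {RV P >-> R}) (y : {RV P >-> 'rV[R]_n}) :
    T -> 'rV[R]_n.+1 := fun w => cons_rV (y w, eps w).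

Let measurable_joint_rV eps y : measurable_fun setT (joint_rV eps y).
Proof.
apply: (measurableT_comp (@measurable_cons_rV R n)).
by apply/measurable_fun_pair; exact: measurable_funPT.
Qed.

HB.instance Definition _ eps y :=
  isMeasurableFun.Build _ _ _ _ (joint_rV eps y) (measurable_joint_rV eps y).

(* For a kernel [phi] on ]0, +oo[, the value [phi 0] is irrelevant: it is only
   reached at z = x - y w, a Lebesgue null set when n > 0. *)
Definition mean_operator (phi : R -> R) (eps : {RV P >-> R})
    (y : {RV P >-> 'rV[R]_n}) (f : 'rV[R]_n -> R) (x : 'rV[R]_n) : \bar R :=
  'E_P[fun w => (eps w ^+ n)^-1 *
    \int[@completed_lebesgue_measure_rV R n]_z
      (phi (enorm (x - z - y w) / eps w) * f z)].

End mean_operator.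

Definition vague_cvg_dirac (R : realType) (m : nat)
    (Pi : nat -> probability 'rV[R]_m R) (a : 'rV[R]_m) :=
  forall h : 'rV[R]_m -> R, continuous h -> bounded_fun h ->
    \int[Pi j]_z h z @[j --> \oo] --> h a.

(* Main.v *)
Require Import Defs.
From HB Require Import structures.
From mathcomp Require Import all_boot all_order all_algebra.
From mathcomp Require Import all_classical all_reals all_analysis.
From mathcomp Require Import measurable_realfun.
From mathcomp Require Import ring lra.

(** Put [k u = phi (enorm u)].  The substitution [z = x - v - e *: u] turns the
    inner integral of the mean operator, at [eps = e] and [y = v], into
    [H (e, v)], the integral over [u] of [k u * g (x - v - e *: u)].  The point
    of this form is that it still makes sense at [e = 0]: as [k] is integrable
    and [g] is bounded and continuous, dominated convergence makes [H] a bounded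
    continuous function on the whole of R^(n+1).  The mean operator is the
    integral of [H] against the joint law of [(eps j, y j)], so the assumed
    convergence of the joint laws, tested on [H] itself, gives the limit
    [H (0, 0)], which is [g x] times the integral of [k].  That integral is 1
    by the normalization of [phi] and polar coordinates.

    The analytic content is therefore twofold.

    - Affine substitution and polar coordinates in R^n.  The first goes by
      induction on the dimension, one Lebesgue integral at a time
      ([lebesgue_measure_rV_affine]).  It makes the measure of a ball
      proportional to the [n]-th power of the radius, so that the law of the
      Euclidean norm under the Lebesgue measure has a density proportional to
      [r ^+ n.-1] on the positive half-line ([density_measure_enorm]); the
      proportionality constant is the area of the sphere ([sphere_areaE]).

    - Completion.  As [phi] is only Lebesgue measurable, it is replaced by a
      Borel function equal to it outside a Borel null set [N]
      ([lebesgue_measurable_fun_borel]).  By polar coordinates the vectors with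
      norm in [N] form a null set of R^n, so that all the integrals with respect
      to completed measures are integrals of Borel functions with respect to
      Borel measures. *)

Set Implicit Arguments.
Unset Strict Implicit.
Unset Printing Implicit Defensive.
Import Order.TTheory GRing.Theory Num.Theory.
Import numFieldNormedType.Exports.

Local Open Scope classical_set_scope.
Local Open Scope ring_scope.

(** * Integrals against image measures and completions *)

Section integral_transfer.
Context d1 d2 (T1 : measurableType d1) (T2 : measurableType d2) (R : realType).
Variables (m1 : {measure set T1 -> \bar R}) (m2 : {measure set T2 -> \bar R}).
Variable i : T1 -> T2.
Hypothesis mi : measurable_fun setT i.
Hypothesis m12 : forall A, measurable A -> m2 A = m1 (i @^-1` A).

(** Stated with an arbitrary [m2] rather than with [pushforward m1 i]: image
    measures are recognized below by their values on measurable sets. *)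
Lemma ge0_integral_image_measure (D : set T2) (f : T2 -> \bar R) :
  measurable D -> measurable_fun D f -> (forall x, D x -> 0 <= f x)%E ->
  (\int[m2]_(x in D) f x = \int[m1]_(x in i @^-1` D) f (i x))%E.
Proof.
move=> mD mf f0.
rewrite -[RHS](ge0_integral_pushforward mi m1 mD mf); last first.
  by move=> x /set_mem; exact: f0.
by apply: eq_measure_integral => A mA _; exact: m12.
Qed.

Lemma integral_image_measure (D : set T2) (f : T2 -> \bar R) :
  measurable D -> measurable_fun D f ->
  (\int[m2]_(x in D) f x = \int[m1]_(x in i @^-1` D) f (i x))%E.
Proof.
move=> mD mf; rewrite integralE [RHS]integralE.
rewrite !ge0_integral_image_measure//.
- by rewrite (funepos_comp f i) (funeneg_comp f i).
- exact: measurable_funeneg.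
- exact: measurable_funepos.
Qed.

(** Meant for [i] the identity from a completed measurable space to the
    original one: [f] becomes measurable on the completed space because it
    agrees with [f0] off a null set. *)
Lemma integral_ae_eq_image_measure (D S : set T2) (f f0 : T2 -> \bar R) :
  measure_is_complete m1 -> measurable D -> measurable_fun D f0 ->
  measurable S -> m2 S = 0%E -> (forall x, D x -> ~ S x -> f x = f0 x) ->
  (\int[m1]_(x in i @^-1` D) f (i x) = \int[m2]_(x in D) f0 x)%E.
Proof.
move=> cm1 mD mf0 mS S0 ff0.
have mp A : measurable A -> measurable (i @^-1` A).
  by move=> mA; rewrite -[X in measurable X]setTI; exact: mi.
have f0f : ae_eq m1 (i @^-1` D) (f0 \o i) (f \o i).
  exists (i @^-1` S); split; [exact: mp|by rewrite -m12|].
  move=> x /= /not_implyP[Dx]; apply: contra_notP => Sx.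
  by apply/esym/ff0.
have mf0i : measurable_fun (i @^-1` D) (f0 \o i).
  move=> _ B mB.
  rewrite [X in measurable X](_ : _ = i @^-1` (D `&` f0 @^-1` B))//.
  by apply: mp; exact: mf0.
rewrite integral_image_measure//; apply/esym/ae_eq_integral => //.
- exact: mp.
- exact: ae_measurable_fun f0f mf0i.
Qed.

End integral_transfer.

(** * Borel representatives of Lebesgue measurable functions *)

(** On [D], [f] is the supremum over the rationals [q >= 0] of
    [q * \1_[f > q]].  Each level set contains a Borel set with a null
    complement in it; replacing the level sets by these inner approximations
    gives a Borel function that never exceeds [f], and is equal to it off the
    countable union of the exceptional sets. *)
Lemma lebesgue_measurable_fun_borel (R : realType) (D : set R) (f : R -> R) :
  measurable D -> lebesgue_measurable_fun D f ->
  (forall x, D x -> 0 <= f x) ->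
  exists (f0 : R -> R) (N : set R), [/\ measurable_fun setT f0,
    forall x, 0 <= f0 x, measurable N, @lebesgue_measure R N = 0%E &
    forall x, D x -> ~ N x -> f x = f0 x].
Proof.
move=> mD mf f_ge0.
pose q n : R := `|ratr (odflt 0 (@unpickle rat n))|.
(* [A] approximates the level set from inside, up to a subset of [M] *)
have hAM n : exists AM : set R * set R, [/\ measurable AM.1, measurable AM.2,
    @lebesgue_measure R AM.2 = 0%E, AM.1 `<=` D `&` f @^-1` `]q n, +oo[ &
    D `&` f @^-1` `]q n, +oo[ `<=` AM.1 `|` AM.2].
  have : ((@wlength R idfun)^*%mu).-cara.-measurable
      (D `&` f @^-1` `]q n, +oo[).
    apply: mf; last exact: measurable_itv.
    exact: sub_caratheodory.
  rewrite -completed_caratheodory_measurable g_sigma_completed_algebra_genE.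
  move=> [A mA [N [M [mM M0 NM]]] AN].
  exists (A, M); split => //=.
    by rewrite -AN; exact: subsetUl.
  by rewrite -AN; exact: setUS.
pose A n := (projT1 (cid (hAM n))).1.
pose M n := (projT1 (cid (hAM n))).2.
have mA n : measurable (A n) by rewrite /A; case: cid => ? [].
have mM n : measurable (M n) by rewrite /M; case: cid => ? [].
have M0 n : @lebesgue_measure R (M n) = 0%E by rewrite /M; case: cid => ? [].
have AD n : A n `<=` D `&` f @^-1` `]q n, +oo[ by rewrite /A; case: cid => ? [].
have DAM n : D `&` f @^-1` `]q n, +oo[ `<=` A n `|` M n.
  by rewrite /A /M; case: cid => ? [].
pose u x n := (q n * \1_(A n) x)%:E.
have u_ge0 x n : (0 <= u x n)%E by rewrite lee_fin mulr_ge0 ?/q.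
exists (fun x => fine (esups (u x) 0%N)), (\bigcup_n M n); split.
- apply: (measurableT_comp (fine_measurable measurableT)).
  apply: measurable_fun_esups => n.
  exact/measurable_EFinP/measurable_funM.
- move=> x; apply/fine_ge0/(le_trans (u_ge0 x 0%N)).
  by apply: ereal_sup_ubound; exists 0%N.
- exact: bigcupT_measurable.
- apply/eqP; rewrite eq_le measure_ge0 andbT.
  apply: le_trans (measure_sigma_subadditive _ _ _ (@subset_refl _ _)) _ => //.
    exact: bigcupT_measurable.
  by rewrite eseries0// => n _ _; exact: M0.
move=> x Dx Nx; have uf : (esups (u x) 0%N <= (f x)%:E)%E.
  apply: ge_ereal_sup => _ [n _ <-]; rewrite lee_fin indicE.
  case: (boolP (x \in A n)) => [/set_mem/AD[_ /=]|_].
    by rewrite mulr1 in_itv/= andbT => /ltW.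
  by rewrite mulr0 f_ge0.
suff -> : esups (u x) 0%N = (f x)%:E by [].
apply/eqP; rewrite eq_le uf/= leNgt; apply/negP => ltuf.
have u0 : (0 <= esups (u x) 0%N)%E.
  apply: (le_trans (u_ge0 x 0%N)).
  by apply: ereal_sup_ubound; exists 0%N.
have ufin : esups (u x) 0%N \is a fin_num.
  by rewrite ge0_fin_numE// (lt_le_trans ltuf)// leey.
(* a rational strictly between the supremum and [f x] gives a level set that
   contains [x], hence a term of the supremum that is too large *)
move: ltuf; rewrite -(fineK ufin) lte_fin => /rat_in_itvoo[r].
rewrite in_itv/= => /andP[ur rf].
have r0 : 0 <= ratr r :> R by apply/ltW/(le_lt_trans _ ur)/fine_ge0.
have qr : q (pickle r) = ratr r by rewrite /q pickleK/= ger0_norm.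
have [|Ax|Mx] := DAM (pickle r) x; last by apply: Nx; exists (pickle r).
  by split => //=; rewrite in_itv/= andbT qr.
have : (u x (pickle r) <= esups (u x) 0%N)%E.
  by apply: ereal_sup_ubound; exists (pickle r).
rewrite -(fineK ufin) lee_fin qr indicE mem_set// mulr1.
by rewrite leNgt ur.
Qed.

(** * Affine maps and the Lebesgue measure *)

Lemma continuous_measurable_rV (R : realType) n (g : 'rV[R]_n -> R) :
  continuous g -> measurable_fun setT g.
Proof.
move=> cg; apply: (measurability _ (RGenOInfty.measurableE R)) => // _ [_ [a ->] <-].
rewrite setTI; apply: sub_sigma_algebra.
by apply: open_comp => [v _|]; [exact: cg|exact: interval_open].
Qed.

Lemma measurable_enorm (R : realType) n : measurable_fun setT (@enorm R n).
Proof.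
apply: measurableT_comp.
  by apply: continuous_measurable_fun; exact: sqrt_continuous.
by apply: measurable_sum => i; apply: measurable_funX; exact: measurable_coord.
Qed.

Lemma measurable_affine_rV (R : realType) n (a : 'rV[R]_n) (e : R) :
  measurable_fun setT (fun u : 'rV[R]_n => a - e *: u).
Proof.
apply: measurable_fun_rV => i.
rewrite (_ : (fun _ => _) = fun u : 'rV[R]_n => a ord0 i - e * u ord0 i).
  apply: measurable_funB => //; apply: measurable_funM => //.
  exact: measurable_coord.
by apply/funext => u; rewrite !mxE.
Qed.

Lemma lebesgue_measure_affine (R : realType) (a e : R) (A : set R) :
  0 < e -> measurable A ->
  @lebesgue_measure R ((fun x => a - e * x) @^-1` A) =
    ((e^-1)%:E * @lebesgue_measure R A)%E.
Proof.
move=> e0 mA.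
pose t (x : measurableTypeR R) : measurableTypeR R := a - e * x.
have mt : measurable_fun setT t.
  by apply: measurable_funB => //; exact: measurable_funM.
pose nu := mscale (NngNum (ltW e0)) (pushforward (@lebesgue_measure R) t).
have nuE B : (nu mt : {measure set _ -> \bar R}) B =
    (e%:E * @lebesgue_measure R (t @^-1` B))%E by [].
rewrite (@lebesgue_measure_unique R (nu mt) _ _ mA) ?nuE.
  by rewrite muleA -EFinM mulVf ?gt_eqF// mul1e.
move=> _ [[x y] _ <-]; rewrite nuE /t /=.
rewrite (_ : _ @^-1` _ = `[(a - y) / e, (a - x) / e[%classic); last first.
  apply/seteqP; split => z /=; rewrite !in_itv/= ler_pdivrMr// ltr_pdivlMr//;
    by move=> /andP[h1 h2]; apply/andP; split; lra.
rewrite !lebesgue_measure_itv/= !lte_fin ltr_pM2r ?invr_gt0// ltrD2l ltrN2.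
case: ifPn => _; last by rewrite mule0.
rewrite -!EFinB -EFinM -mulrBl mulrC -mulrA mulVf ?gt_eqF// mulr1.
by congr (_%:E); ring.
Qed.

Lemma cons_rV_head (R : realType) n (p : 'rV[R]_n * R) :
  cons_rV p ord0 ord0 = p.2.
Proof.
rewrite (_ : ord0 = lshift n (@ord0 0)); last exact/val_inj.
by rewrite [LHS](@row_mxEl _ 1 1 n) mxE !ord1.
Qed.

Lemma cons_rV_tail (R : realType) n (p : 'rV[R]_n * R) i :
  cons_rV p ord0 (lift ord0 i) = p.1 ord0 i.
Proof.
rewrite (_ : lift ord0 i = rshift 1 i); last exact/val_inj.
by rewrite [LHS](@row_mxEr _ 1 1 n).
Qed.

Definition tail_rV (R : realType) n (v : 'rV[R]_n.+1) : 'rV[R]_n :=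
  \row_i v ord0 (lift ord0 i).

Lemma tail_cons_rV (R : realType) n (p : 'rV[R]_n * R) :
  tail_rV (cons_rV p) = p.1.
Proof. by apply/rowP => i; rewrite mxE cons_rV_tail. Qed.

Lemma affine_cons_rV (R : realType) n (a : 'rV[R]_n.+1) (e : R)
    (p : 'rV[R]_n * R) :
  a - e *: cons_rV p = cons_rV (tail_rV a - e *: p.1, a ord0 ord0 - e * p.2).
Proof.
apply/matrixP => k i; have -> : k = ord0 by exact: ord1.
have := cons_rV_tail p; have := cons_rV_head p.
move: (cons_rV p) => c c0 cS; have [j ->|->] := unliftP ord0 i.
  by rewrite [RHS]cons_rV_tail !mxE cS.
by rewrite [RHS]cons_rV_head !mxE c0.
Qed.

(** Fubini in the first coordinate: the sections of the preimage are affine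
    preimages on the line of sections of [A], which gives one factor [e^-1]; the
    induction hypothesis, read as an equality of measures on R^n, gives the
    others. *)
Lemma lebesgue_measure_rV_affine (R : realType) n (a : 'rV[R]_n) (e : R) A :
  0 < e -> measurable A ->
  lebesgue_measure_rV n ((fun u => a - e *: u) @^-1` A) =
  (((e ^+ n)^-1)%:E * lebesgue_measure_rV n A)%E.
Proof.
move=> e0; elim: n a A => [|n IHn] a A mA.
  rewrite expr0 invr1 mul1e /=; congr (\d_ _ _).
  have aE x : a - e *: x = x by apply/rowP; case.
  by apply/seteqP; split => x /=; rewrite aE.
have mcA : measurable (@cons_rV R n @^-1` A).
  by rewrite -[X in measurable X]setTI; exact: measurable_cons_rV.
pose h x := @lebesgue_measure R (xsection (@cons_rV R n @^-1` A) x).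
have mh : measurable_fun setT h.
  exact: (measurable_fun_xsection (@lebesgue_measure R) mcA).
have en0 k : 0 <= (e ^+ k)^-1 by rewrite invr_ge0 exprn_ge0// ltW.
transitivity (\int[lebesgue_measure_rV n]_x
    ((e^-1)%:E * h (tail_rV a - e *: x)%R))%E.
  apply: eq_integral => x _ /=.
  rewrite -(lebesgue_measure_affine (a ord0 ord0))//; last first.
    exact: measurable_xsection.
  congr (lebesgue_measure _); apply/seteqP; split => r /=;
    by rewrite /xsection/= !inE/= affine_cons_rV.
rewrite ge0_integralZl//; last 2 first.
- apply: (measurableT_comp mh); exact: measurable_affine_rV.
- by rewrite lee_fin invr_ge0 ltW.
rewrite -[X in (_ * X)%E](@ge0_integral_image_measure _ _ _ _ R
  (lebesgue_measure_rV n) (mscale (NngNum (en0 n)) (lebesgue_measure_rV n))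
  (fun u => tail_rV a - e *: u) _ _ setT h)//; last 2 first.
- exact: measurable_affine_rV.
- by move=> B mB; rewrite [RHS]IHn.
rewrite ge0_integral_mscale//= muleA -EFinM.
by rewrite exprS invfM.
Qed.

(** * Measures with a density *)

Lemma ge0_integral_mrestr d (T : measurableType d) (R : realType)
    (mu : {measure set T -> \bar R}) (D : set T) (mD : measurable D)
    (f : T -> \bar R) : measurable_fun setT f -> (forall x, 0 <= f x)%E ->
  (\int[mrestr mu mD]_x f x = \int[mu]_(x in D) f x)%E.
Proof.
move=> mf f0; rewrite -[X in integral _ X](setUv D) ge0_integral_setU//=.
- rewrite [X in (_ + X)%E](_ : _ = 0%E) ?adde0.
    by apply: eq_measure_integral => A mA AD; rewrite -[LHS]/(mu (A `&` D)) setIidl.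
  rewrite (@eq_measure_integral _ _ _ _ mzero) ?integral_measure_zero//.
  move=> A mA AD; rewrite -[LHS]/(mu (A `&` D)) (_ : A `&` D = set0) ?measure0//.
  by apply/seteqP; split => // x [/AD].
- exact: measurableC.
- exact: measurable_funTS.
- by apply/disj_setPS; rewrite setICr.
Qed.

Section density.
Context d (T : measurableType d) {R : realType}.
Variable mu : {sigma_finite_measure set T -> \bar R}.
Local Notation lam := (@lebesgue_measure R).
Variable w : T -> R.
Hypotheses (mw : measurable_fun setT w) (w_ge0 : forall x, 0 <= w x).

(** The measure with density [w] is the area under the graph of [w], projected
    onto the abscissa: it is a measure by construction, and the formula for
    integrals against it is an instance of Tonelli's theorem. *)
Let hypograph : set (T * measurableTypeR R) := [set p | 0 <= p.2 < w p.1].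

Let measurable_hypograph : measurable hypograph.
Proof.
rewrite (_ : hypograph = (fun p => 0 <= p.2) @^-1` [set true] `&`
    (fun p => p.2 < w p.1) @^-1` [set true]); last first.
  by apply/seteqP; split => p /=; [move=> /andP[]|move=> [? ?]; exact/andP].
apply: measurableI; rewrite -[X in measurable X]setTI.
  have : measurable_fun setT (fun p : T * measurableTypeR R => 0 <= p.2).
    by apply: measurable_fun_ler => //; exact: measurable_snd.
  exact.
have : measurable_fun setT (fun p : T * measurableTypeR R => p.2 < w p.1).
  apply: measurable_fun_ltr; first exact: measurable_snd.
  exact: (measurableT_comp mw measurable_fst).
exact.
Qed.

Let mfst : measurable_fun setT (@fst T (measurableTypeR R)).
Proof. exact: measurable_fst. Qed.

Let area : {measure set (T * measurableTypeR R) -> \bar R} :=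
  mrestr (mu \x lam)%E measurable_hypograph.

Definition density_measure : set T -> \bar R := pushforward area fst.

HB.instance Definition _ := Measure.copy density_measure
  (Measure.clone _ _ _ (pushforward area fst) (_ mfst)).

Lemma ge0_integral_density_measure (f : T -> \bar R) :
  measurable_fun setT f -> (forall x, 0 <= f x)%E ->
  (\int[density_measure]_x f x = \int[mu]_x (f x * (w x)%:E))%E.
Proof.
move=> mf f0.
rewrite ge0_integral_pushforward//=.
rewrite ge0_integral_mrestr//=; last exact: measurableT_comp.
rewrite integral_mkcond fubini_tonelli1//=; last 2 first.
- apply/(measurable_restrictT _ measurable_hypograph)/measurable_funTS.
  exact: measurableT_comp.
- by move=> p; rewrite erestrict_ge0.
apply: eq_integral => x _; rewrite /fubini_F.
transitivity (\int[lam]_(y in `[0%R, w x[) f x)%E.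
  rewrite [RHS]integral_mkcond; apply: eq_integral => y _.
  rewrite !patchE (_ : ((x, y) \in hypograph) = (y \in `[0%R, w x[%classic)).
    by case: ifP.
  by apply/idP/idP => /set_mem xy; apply/mem_set; move: xy; rewrite /= in_itv.
rewrite integral_cst//= lebesgue_measure_itv/= lte_fin.
by case: ltP => [|wx0]; rewrite ?sube0// (le_anti (introT andP (conj wx0 (w_ge0 x)))).
Qed.

Lemma density_measureE A : measurable A ->
  density_measure A = (\int[mu]_(x in A) (w x)%:E)%E.
Proof.
move=> mA; transitivity (\int[density_measure]_x (\1_A x)%:E)%E.
  by rewrite integral_indic// setIT.
rewrite ge0_integral_density_measure//; last exact/measurable_EFinP.
rewrite [RHS]integral_mkcond; apply: eq_integral => x _.
by rewrite patchE indicE; case: (x \in A); rewrite ?mul1e ?mul0e.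
Qed.

End density.

(** * The law of the Euclidean norm *)

(** For [c] the volume of the unit ball, the area of the sphere of radius [r] *)
Definition radial_density (R : realType) (n : nat) (c r : R) : R :=
  if 0 < r then c * (n%:R * r ^+ n.-1) else 0.

Lemma radial_density_ge0 (R : realType) n (c r : R) :
  0 <= c -> 0 <= radial_density n c r.
Proof.
move=> c0; rewrite /radial_density; case: ifPn => // r0.
by rewrite !mulr_ge0// exprn_ge0// ltW.
Qed.

Lemma measurable_radial_density (R : realType) n (c : R) :
  measurable_fun setT (radial_density n c).
Proof.
apply: measurable_fun_ifT => //; first exact: measurable_fun_ltr.
by apply: measurable_funM => //; apply: measurable_funM => //; exact: exprn_measurable.
Qed.

(** [Num.max _ 0] covers at once the intervals that meet the negative half-line,
    where the density is zero. *)
Lemma integral_radial_density (R : realType) n (c a b : R) : (0 < n)%N -> a <= b ->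
  (\int[@lebesgue_measure R]_(r in `]a, b]) (radial_density n c r)%:E)%E =
  (c * Num.max b 0 ^+ n - c * Num.max a 0 ^+ n)%:E.
Proof.
move=> n0 ab; set a' := Num.max a 0; set b' := Num.max b 0.
have ab' : a' <= b' by rewrite le_max2// ab.
pose f r : R := c * (n%:R * r ^+ n.-1).
have cf : continuous f.
  move=> x; apply: cvgM; first exact: cvg_cst.
  by apply: cvgM; [exact: cvg_cst|exact: exprn_continuous].
transitivity (\int[@lebesgue_measure R]_(r in `]a', b']) (f r)%:E)%E.
  rewrite integral_mkcond [RHS]integral_mkcond; apply: eq_integral => r _.
  rewrite !patchE !mem_setE !in_itv/= /a' /b' gt_max le_max /radial_density.
  rewrite [in RHS](leNgt r 0); case: (ltP 0 r) => r0; last by rewrite andbF if_same.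
  by rewrite !(andbT, orbF).
have [<-|a'b'] := eqVneq a' b'; first by rewrite set_itvoc0 integral_set0 subrr.
have lt_ab : a' < b' by rewrite lt_neqAle a'b'.
rewrite integral_itv_obnd_cbnd; last first.
  apply/measurable_EFinP; apply: measurable_funTS.
  exact: continuous_measurable_fun.
have dF (x : R) : is_derive x 1 (fun x : R => c * x ^+ n) (f x).
  have -> : (fun x : R => c * x ^+ n) = c \*: ((id : R -> R) ^+ n).
    by apply/funext => z; rewrite /= exprfctE.
  apply: (is_derive_eq (is_deriveZ c (is_deriveX n (is_derive_id x (1 : R))))).
  by rewrite /f /GRing.scale/= mulr1.
have cF : continuous (fun x : R => c * x ^+ n).
  by move=> x; apply: cvgM; [exact: cvg_cst|exact: exprn_continuous].
rewrite (@continuous_FTC2 _ f (fun x : R => c * x ^+ n))//.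
- exact: continuous_subspaceT.
- split => [x _||]; first by have [] := dF x.
  + exact/cvg_at_right_filter/cF.
  + exact/cvg_at_left_filter/cF.
- by move=> x _; rewrite derive1E; exact: derive_val.
Qed.

Section euclidean_ball.
Context {R : realType}.

Lemma enorm_ge0 n (u : 'rV[R]_n) : 0 <= enorm u.
Proof. exact: sqrtr_ge0. Qed.

Lemma enormZ n (e : R) (u : 'rV[R]_n) : enorm (e *: u) = `|e| * enorm u.
Proof.
rewrite /enorm; under eq_bigr do rewrite mxE exprMn.
by rewrite -mulr_sumr sqrtrM ?sqr_ge0// sqrtr_sqr.
Qed.

Lemma enormN n (u : 'rV[R]_n) : enorm (- u) = enorm u.
Proof. by rewrite -scaleN1r enormZ normrN1 mul1r. Qed.

Lemma ler_coord_enorm n (u : 'rV[R]_n) i : `|u ord0 i| <= enorm u.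
Proof.
rewrite -sqrtr_sqr; apply: ler_wsqrtr.
by rewrite (bigD1 i)//= lerDl sumr_ge0// => j _; exact: sqr_ge0.
Qed.

Definition euclidean_ball n (r : R) : set 'rV[R]_n := [set u | enorm u <= r].

Lemma measurable_enorm_preimage n (A : set R) :
  measurable A -> measurable (@enorm R n @^-1` A).
Proof.
by move=> mA; rewrite -[X in measurable X]setTI; exact: measurable_enorm.
Qed.

Lemma euclidean_ballE n r : @euclidean_ball n r = @enorm R n @^-1` `]-oo, r].
Proof. by apply/seteqP; split => u /=; rewrite in_itv. Qed.

Lemma measurable_euclidean_ball n r : measurable (@euclidean_ball n r).
Proof. by rewrite euclidean_ballE; exact: measurable_enorm_preimage. Qed.

Definition unit_ball_volume n : R :=
  fine (lebesgue_measure_rV n (@euclidean_ball n 1)).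

Lemma unit_ball_volume_ge0 n : 0 <= unit_ball_volume n.
Proof. exact: fine_ge0. Qed.

(** For [r > 0] the ball is the image of the unit ball by a homothety; for
    [r <= 0] it is contained in a degenerate box, since [n > 0]. *)
Lemma lebesgue_measure_rV_euclidean_ball n r : (0 < n)%N ->
  lebesgue_measure_rV n (@euclidean_ball n r) =
  (unit_ball_volume n * Num.max r 0 ^+ n)%:E.
Proof.
move=> n0.
have box_measurable (A : 'I_n -> set R) : (forall i, measurable (A i)) ->
    measurable [set v : 'rV[R]_n | forall i, A i (v ord0 i)].
  move=> mA; rewrite (_ : [set v | _] = \bigcap_(i in [set: 'I_n])
      ((fun v : 'rV[R]_n => v ord0 i) @^-1` A i)).
    apply: fin_bigcap_measurable => [|i _]; first exact: finite_finset.
    by rewrite -[X in measurable X]setTI; exact: measurable_coord.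
  by apply/seteqP; split => [t ht i _|t ht i]; exact: ht.
have [r0|r0] := leP r 0.
  rewrite expr0n gtn_eqF// mulr0; apply/eqP; rewrite eq_le measure_ge0 andbT.
  have box0 : lebesgue_measure_rV n
      [set v : 'rV[R]_n | forall i, [set 0 : R] (v ord0 i)] = 0%E.
    rewrite (@lebesgue_measure_rV_box R n (fun=> [set 0]))//.
    by rewrite (bigD1 (Ordinal n0))//= lebesgue_measure_set1 mul0e.
  rewrite -[leRHS]/0%E -box0; apply: le_measure; rewrite ?inE.
  - exact: measurable_euclidean_ball.
  - exact: (box_measurable (fun=> [set 0])).
  - move=> u /= ur i; apply/eqP; rewrite -normr_le0.
    exact/(le_trans (ler_coord_enorm u i))/(le_trans ur).
(* the unit ball lies in a bounded box, so [unit_ball_volume], which is a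
   [fine], is its actual measure *)
have fin1 : lebesgue_measure_rV n (@euclidean_ball n 1) \is a fin_num.
  rewrite ge0_fin_numE//.
  apply: (@le_lt_trans _ _ (lebesgue_measure_rV n
      [set v : 'rV[R]_n | forall i, `[-1, 1]%classic (v ord0 i)])).
    apply: le_measure; rewrite ?inE.
    - exact: measurable_euclidean_ball.
    - apply: (box_measurable (fun=> `[-1, 1]%classic)) => i.
      exact: measurable_itv.
    - move=> u /= ur i; rewrite /= in_itv/= -ler_norml.
      exact/(le_trans (ler_coord_enorm u i)).
  rewrite (@lebesgue_measure_rV_box R n (fun=> `[-1, 1]%classic))//.
  under eq_bigr do rewrite lebesgue_measure_itv.
  by rewrite ltey_eq prode_fin_num// => i _; case: ifP.
have := lebesgue_measure_rV_affine 0 r0 (@measurable_euclidean_ball n r).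
rewrite (_ : _ @^-1` _ = @euclidean_ball n 1); last first.
  have rE (v : 'rV[R]_n) : (r * enorm v <= r) = (enorm v <= 1).
    by rewrite -{2}[r]mulr1 ler_pM2l.
  by apply/seteqP; split => u /=;
    rewrite /euclidean_ball/= sub0r enormN enormZ gtr0_norm// rE.
rewrite -(fineK fin1) -/(unit_ball_volume n) => volE.
rewrite EFinM volE [RHS]muleC muleA -EFinM mulfV ?mul1e//.
by rewrite expf_neq0// gt_eqF.
Qed.

End euclidean_ball.

Section polar_coordinates.
Context {R : realType} (n : nat).
Hypothesis n_gt0 : (0 < n)%N.
Local Notation lam := (@lebesgue_measure R).

Let w : measurableTypeR R -> R := radial_density n (unit_ball_volume n).

Let mw : measurable_fun setT w.
Proof. exact: measurable_radial_density. Qed.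

Let w_ge0 r : 0 <= w r.
Proof. exact/radial_density_ge0/unit_ball_volume_ge0. Qed.

Let menorm : measurable_fun setT (@enorm R n : _ -> measurableTypeR R).
Proof. exact: measurable_enorm. Qed.

(** Both measures give a half-open interval [`]a, b]] the difference of the
    measures of two balls, and these intervals generate the Borel sets. *)
Lemma density_measure_enorm (A : set R) : measurable A ->
  density_measure lam mw A = lebesgue_measure_rV n (@enorm R n @^-1` A).
Proof.
move=> mA.
have nu_oc a b : a <= b ->
    lebesgue_measure_rV n (@enorm R n @^-1` `]a, b]%classic) =
    (unit_ball_volume n * Num.max b 0 ^+ n -
     unit_ball_volume n * Num.max a 0 ^+ n)%:E.
  move=> ab; rewrite (_ : _ @^-1` _ = euclidean_ball b `\` euclidean_ball a).
    rewrite measureD//; [|exact: measurable_euclidean_ball..|].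
      rewrite setIidr; last by move=> u /= /le_trans; exact.
      by rewrite EFinB; congr (_ - _)%E; exact: lebesgue_measure_rV_euclidean_ball.
    by rewrite [X in (X < _)%E](lebesgue_measure_rV_euclidean_ball b n_gt0) ltry.
  apply/seteqP; split => u /=; rewrite /euclidean_ball/= in_itv/=.
    by move=> /andP[au ub]; split => //; apply/negP; rewrite -ltNge.
  by move=> [ub /negP]; rewrite -ltNge => au; apply/andP.
pose g (k : nat) : set (measurableTypeR R) := `](- k%:R : R), k%:R]%classic.
pose nu : {measure set (measurableTypeR R) -> \bar R} :=
  Measure.clone _ _ _ (pushforward (lebesgue_measure_rV n)
  (@enorm R n : _ -> measurableTypeR R)) (_ menorm).
rewrite -[RHS]/(nu A); apply/esym.
apply: (@measure_unique _ R (measurableTypeR R) (@ocitv R) g) => //.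
- exact: ocitvI.
- by move=> k; exact: is_ocitv.
- apply/seteqP; split => // x _; exists (Num.bound `|x|) => //.
  have := archi_boundP (normr_ge0 x); rewrite ltr_norml => /andP[xk kx].
  by rewrite /g/= in_itv/= xk ltW.
- move=> _ [[a b] _ <-].
  have [ab|ba] := leP a b; last by rewrite set_itv_ge ?measure0// bnd_simp -leNgt ltW.
  rewrite [LHS]nu_oc// -integral_radial_density//.
  apply/esym; apply: (density_measureE lam mw w_ge0).
  exact: measurable_itv.
- move=> k; rewrite [X in (X < _)%E]nu_oc ?ltry//.
  by rewrite (@le_trans _ _ 0)// oppr_le0.
Qed.

(** Polar coordinates: a radial integrand sees only the law of the norm. *)
Lemma ge0_integral_enorm (f : R -> \bar R) :
  measurable_fun setT f -> (forall r, 0 <= f r)%E ->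
  (\int[lebesgue_measure_rV n]_u f (enorm u) =
   \int[lam]_r (f r * (radial_density n (unit_ball_volume n) r)%:E))%E.
Proof.
move=> mf f0; rewrite -(ge0_integral_density_measure lam mw w_ge0)//.
by rewrite (ge0_integral_image_measure menorm density_measure_enorm).
Qed.

End polar_coordinates.

(** * Radial integrals for the completed measures *)

Section completion.
Context {R : realType}.

Local Notation completed_R := (caratheodory_type (@wlength R idfun)^*%mu).
Local Notation completed_rV n :=
  (caratheodory_type (@lebesgue_measure_rV R n)^*%mu).

Lemma integral_completed_lebesgue_measure (D N : set R) (f f0 : R -> \bar R) :
  measurable D -> measurable_fun D f0 -> measurable N ->
  @lebesgue_measure R N = 0%E -> (forall x, D x -> ~ N x -> f x = f0 x) ->
  (\int[@completed_lebesgue_measure R]_(x in D) f x =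
   \int[@lebesgue_measure R]_(x in D) f0 x)%E.
Proof.
move=> mD mf0 mN N0 ff0.
have mi : measurable_fun setT (idfun : completed_R -> measurableTypeR R).
  by move=> _ A mA; rewrite setTI; exact: sub_caratheodory.
apply: (integral_ae_eq_image_measure mi _ completed_lebesgue_measure_is_complete
  mD mf0 mN N0 ff0) => A mA.
by [].
Qed.

Lemma completed_lebesgue_measure_rVE n (A : set 'rV[R]_n) : measurable A ->
  completed_lebesgue_measure_rV A = lebesgue_measure_rV n A.
Proof. by move=> mA; exact: measurable_mu_extE. Qed.

Lemma integral_completed_lebesgue_measure_rV n (N : set 'rV[R]_n)
    (f f0 : 'rV[R]_n -> \bar R) :
  measurable_fun setT f0 -> measurable N -> lebesgue_measure_rV n N = 0%E ->
  (forall x, ~ N x -> f x = f0 x) ->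
  (\int[@completed_lebesgue_measure_rV R n]_x f x =
   \int[lebesgue_measure_rV n]_x f0 x)%E.
Proof.
move=> mf0 mN N0 ff0.
have mi : measurable_fun setT (idfun : completed_rV n -> 'rV[R]_n).
  move=> _ A mA; rewrite setTI; apply: sub_caratheodory.
  exact: sub_sigma_algebra.
apply: (integral_ae_eq_image_measure mi _ _ measurableT mf0 mN N0
  (fun x _ => ff0 x)) => [A mA|].
  exact/esym/completed_lebesgue_measure_rVE.
exact: measure_is_complete_caratheodory.
Qed.

End completion.

Section normalized_kernel.
Context {R : realType} (n : nat).
Hypothesis n_gt0 : (0 < n)%N.

(** The half-line [`]-oo, 0]] is adjoined because a kernel on the positive
    half-line is uncontrolled there: only the zero vector has its norm in it. *)
Lemma lebesgue_measure_rV_enorm_null (N : set R) :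
  measurable N -> @lebesgue_measure R N = 0%E ->
  lebesgue_measure_rV n (@enorm R n @^-1` (N `|` `]-oo, 0])) = 0%E.
Proof.
move=> mN N0.
have nullN : lebesgue_measure_rV n (@enorm R n @^-1` N) = 0%E.
  rewrite -density_measure_enorm// density_measureE//.
    apply: null_set_integral => //.
    apply/measurable_EFinP; apply: measurable_funTS; exact: measurable_radial_density.
  by move=> r; exact/radial_density_ge0/unit_ball_volume_ge0.
have ball0 : lebesgue_measure_rV n (@euclidean_ball R n 0) = 0%E.
  by rewrite lebesgue_measure_rV_euclidean_ball// maxxx expr0n gtn_eqF// mulr0.
rewrite preimage_setU -euclidean_ballE.
apply/eqP; rewrite eq_le measure_ge0 andbT.
apply: (le_trans (measureU2 _ _ _)).
- exact: measurable_enorm_preimage.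
- exact: measurable_euclidean_ball.
by rewrite [X in (X + _)%E]nullN [X in (_ + X)%E]ball0 adde0.
Qed.

(** The cone over the unit sphere is the open unit ball without its center, and
    the law of the norm shows that it has the measure of the closed ball. *)
Lemma sphere_areaE : sphere_area R n = (n%:R * unit_ball_volume n)%:E.
Proof.
rewrite /sphere_area /surface_measure EFinM; congr (_ * _)%E.
rewrite (_ : [set _ | _ in _ & _ in _] = @enorm R n @^-1` `]0, 1[); last first.
  apply/seteqP; split => [_ [r /= r01 [u /= u1 <-]]|u /= u01].
    move: r01; rewrite /= !in_itv/= enormZ u1 mulr1 => /andP[r0 r1].
    by rewrite gtr0_norm// r0.
  exists (enorm u) => //; exists ((enorm u)^-1 *: u) => /=.
    rewrite enormZ ger0_norm ?invr_ge0 ?enorm_ge0// mulVf//.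
    by move: u01; rewrite in_itv/= => /andP[/gt_eqF ->].
  rewrite scalerA mulfV ?scale1r//.
  by move: u01; rewrite in_itv/= => /andP[/gt_eqF ->].
rewrite completed_lebesgue_measure_rVE; last exact: measurable_enorm_preimage.
rewrite -density_measure_enorm// density_measureE//; last first.
  by move=> r; exact/radial_density_ge0/unit_ball_volume_ge0.
rewrite integral_itv_bndo_bndc; last first.
  apply/measurable_EFinP; apply: measurable_funTS; exact: measurable_radial_density.
rewrite integral_radial_density//.
by rewrite maxxx (max_idPl _)// expr1n expr0n gtn_eqF// mulr1 mulr0 subr0.
Qed.

(** The right-hand side is the quantity that the normalization of the kernel
    sets to 1. *)
Lemma integral_normalized_kernel (phi phi0 : R -> R) (N : set R) :
  measurable_fun setT phi0 -> (forall r, 0 <= phi0 r) ->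
  measurable N -> @lebesgue_measure R N = 0%E ->
  (forall r, 0 < r -> ~ N r -> phi r = phi0 r) ->
  (\int[lebesgue_measure_rV n]_u (phi0 (enorm u))%:E =
   sphere_area R n * \int[@completed_lebesgue_measure R]_(rho in `]0%R, +oo[)
     (rho ^+ n.-1 * phi rho)%:E)%E.
Proof.
move=> mphi0 phi0_ge0 mN N0 phiE.
have mF : measurable_fun setT (fun r : R => (r ^+ n.-1 * phi0 r)%:E).
  by apply/measurable_EFinP; apply: measurable_funM => //; exact: exprn_measurable.
rewrite (@integral_completed_lebesgue_measure R _ N _
  (fun r => (r ^+ n.-1 * phi0 r)%:E))//; last first.
- by move=> r /=; rewrite in_itv/= andbT => r0 Nr; rewrite phiE.
- exact: measurable_funTS.
have mphi0E : measurable_fun setT (EFin \o phi0) by exact/measurable_EFinP.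
have phi0E_ge0 r : (0 <= (EFin \o phi0) r)%E by rewrite lee_fin.
rewrite [LHS](ge0_integral_enorm n_gt0 mphi0E phi0E_ge0).
rewrite sphere_areaE -ge0_integralZl//; last 3 first.
- exact: measurable_funTS.
- move=> r /=; rewrite in_itv/= andbT => r0.
  by rewrite lee_fin mulr_ge0// exprn_ge0// ltW.
- by rewrite lee_fin mulr_ge0// unit_ball_volume_ge0.
rewrite [RHS]integral_mkcond; apply: eq_integral => r _.
rewrite patchE mem_setE in_itv/= andbT /radial_density.
case: ifPn => _; last by rewrite mule0.
by rewrite -!EFinM; congr (_%:E); ring.
Qed.

End normalized_kernel.

(** * Continuity of averages *)

(** Reduces continuity to sequences, for which dominated convergence holds *)
Lemma seq_continuous_at (R : realType) (T : pseudoMetricType R) (f : T -> R)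
    (p : T) :
  (forall q : nat -> T, q i @[i --> \oo] --> p ->
    f (q i) @[i --> \oo] --> f p) ->
  {for p, continuous f}.
Proof.
move=> fp; apply: contrapT => nfp.
have [e e0 he] : exists2 e : R, 0 < e &
    forall d, 0 < d -> exists2 z, ball p d z & e <= `|f p - f z|.
  apply: contrapT => h; apply: nfp; apply/cvgrPdist_lt => e e0.
  apply: contrapT => nnear; apply: h; exists e => // d d0.
  apply: contrapT => h; apply: nnear.
  apply/nbhs_ballP; exists d => //= z pz; rewrite ltNge; apply/negP => ez.
  by apply: h; exists z.
have i0 (i : nat) : 0 < i.+1%:R^-1 :> R by rewrite invr_gt0.
pose q i := projT1 (cid2 (he _ (i0 i))).
have qp i : ball p i.+1%:R^-1 (q i) by rewrite /q; case: cid2.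
have qe i : e <= `|f p - f (q i)| by rewrite /q; case: cid2.
have /fp /cvgrPdist_lt/(_ _ e0) : q i @[i --> \oo] --> p.
  apply/cvg_ballP => d d0; near=> i.
  apply: (le_ball _ (qp i)); apply: ltW; near: i.
  exact: near_infty_natSinv_lt (PosNum d0).
by move=> [i _ /(_ i (leqnn i))]; rewrite ltNge qe.
Unshelve. all: by end_near. Qed.

Lemma tail_rV_continuous (R : realType) n : continuous (@tail_rV R n).
Proof.
move=> p A /nbhs_ballP[e /= e0 eA]; apply/nbhs_ballP; exists e => //= q [_ pq].
by apply: eA; split => // i j; rewrite !mxE; exact: pq.
Qed.

Lemma bounded_fun_le (R : realType) (T : Type) (g : T -> R) :
  bounded_fun g -> exists2 M, 0 <= M & forall x, `|g x| <= M.
Proof.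
move=> [M [_ gM]]; exists (`|M| + 1) => [|x]; first by rewrite addr_ge0.
by apply: gM => //; rewrite (le_lt_trans (ler_norm M))// ltrDl.
Qed.

Section averaging.
Context {R : realType} (n : nat) (mu : {measure set 'rV[R]_n -> \bar R}).
Variables (k g : 'rV[R]_n -> R) (x : 'rV[R]_n).
Hypothesis ik : mu.-integrable setT (EFin \o k).
Hypotheses (cg : continuous g) (bg : bounded_fun g).

(** In the vector [p], the first coordinate is the scale and the others are the
    translation, as in [joint_rV]. *)
Definition averaging (p : 'rV[R]_n.+1) : R :=
  \int[mu]_u (k u * g (x - tail_rV p - p ord0 ord0 *: u)).

Let F (p : 'rV[R]_n.+1) (u : 'rV[R]_n) : \bar R :=
  (k u * g (x - tail_rV p - p ord0 ord0 *: u))%:E.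

Let mk : measurable_fun setT k.
Proof. by apply/measurable_EFinP; exact: measurable_int ik. Qed.

Let mF p : measurable_fun setT (F p).
Proof.
apply/measurable_EFinP; apply: measurable_funM => //.
apply: measurableT_comp; first exact: continuous_measurable_rV.
exact: measurable_affine_rV.
Qed.

Let dominator M : mu.-integrable setT (EFin \o (fun u => M * `|k u|)).
Proof.
apply: (@eq_integrable _ _ _ _ _ _ (fun u => M%:E * (abse \o (EFin \o k)) u)%E) => //.
by apply: integrableZl => //; exact: integrable_abse.
Qed.

Let F_le M p u : (forall v, `|g v| <= M) -> (`|F p u| <= (M * `|k u|)%:E)%E.
Proof. by move=> gM; rewrite lee_fin normrM mulrC ler_wpM2r. Qed.

Lemma integrable_averaging p :
  mu.-integrable setT (fun u => (k u * g (x - tail_rV p - p ord0 ord0 *: u))%:E).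
Proof.
have [M M0 gM] := bounded_fun_le bg.
apply: (le_integrable measurableT (mF p) _ (dominator M)) => u _ /=.
by apply: le_trans (F_le _ _ gM) _; rewrite lee_fin ler_norm.
Qed.

Lemma averaging_continuous : continuous averaging.
Proof.
have [M M0 gM] := bounded_fun_le bg.
move=> p; apply: seq_continuous_at => q qp; rewrite /averaging.
apply: fine_cvg; rewrite fineK; last first.
  exact/integrable_fin_num/integrable_averaging.
apply: (@dominated_cvg _ _ _ mu setT measurableT _ (F p)
  (EFin \o (fun u => M * `|k u|))) => //.
- by move=> i; exact: mF.
- move=> u _; apply/fine_cvgP; split; first by near=> i.
  rewrite (_ : fine \o _ = fun i => k u * g (x - tail_rV (q i) - q i ord0 ord0 *: u))//.
  apply: cvgM; first exact: cvg_cst.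
  apply: continuous_cvg; first exact: cg.
  apply: cvgB.
    apply: cvgB; first exact: cvg_cst.
    by apply: continuous_cvg qp; exact: tail_rV_continuous.
  apply: cvgZ; last exact: cvg_cst.
  have head_continuous :
      {for p, continuous (fun M : 'rV[R]_n.+1 => M ord0 ord0)}.
    exact: coord_continuous.
  exact: (continuous_cvg _ head_continuous qp).
- by move=> i u _; exact: F_le.
Unshelve. all: by end_near. Qed.

Lemma averaging_bounded : bounded_fun averaging.
Proof.
have [M M0 gM] := bounded_fun_le bg.
exists (\int[mu]_u (M * `|k u|)); split; first exact: num_real.
move=> B MB p _; apply: le_trans (ltW MB).
apply: le_trans (le_normr_Rintegral _ (integrable_averaging p)) _ => //.
apply: le_Rintegral => //.
- exact: (integrable_norm (integrable_averaging p)).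
- by move=> u _; have := F_le p u gM; rewrite lee_fin.
Qed.

Lemma averaging0 : averaging 0 = (\int[mu]_u k u) * g x.
Proof.
rewrite -RintegralZr//; apply: eq_Rintegral => u _.
rewrite mxE scale0r subr0 (_ : tail_rV 0 = 0) ?subr0//.
by apply/rowP => i; rewrite !mxE.
Qed.

End averaging.

(** * The mean operator as an average *)

Lemma gt0_muleBr (R : realDomainType) (k : R) (a b : \bar R) : 0 < k ->
  (k%:E * (a - b) = k%:E * a - k%:E * b)%E.
Proof.
move=> k0; case: a b => [a| |] [b| |] //=;
  rewrite ?(gt0_muley, gt0_muleNy, lte_fin)//=.
by rewrite -!EFinM -EFinB mulrBr.
Qed.

(** No integrability is required: a positive factor distributes over the
    difference of the positive and negative parts even when both are infinite. *)
Lemma integral_mscale d (T : measurableType d) (R : realType)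
    (mu : {measure set T -> \bar R}) (k : {nonneg R}) (f : T -> \bar R) :
  0 < k%:num -> measurable_fun setT f ->
  (\int[mscale k mu]_x f x = k%:num%:E * \int[mu]_x f x)%E.
Proof.
move=> k0 mf; rewrite [LHS]integralE [X in (_ * X)%E]integralE gt0_muleBr//.
have mp := measurable_funepos mf; have mn := measurable_funeneg mf.
by rewrite !ge0_integral_mscale.
Qed.

Lemma integral_affine_rV (R : realType) n (a : 'rV[R]_n) (e : R)
    (f : 'rV[R]_n -> \bar R) : 0 < e -> measurable_fun setT f ->
  (\int[lebesgue_measure_rV n]_u f (a - e *: u)%R =
   ((e ^+ n)^-1)%:E * \int[lebesgue_measure_rV n]_z f z)%E.
Proof.
move=> e0 mf.
have en0 : 0 < (e ^+ n)^-1 by rewrite invr_gt0 exprn_gt0.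
rewrite -(@integral_mscale _ _ _ _ (NngNum (ltW en0)))//.
rewrite [RHS](integral_image_measure (m1 := lebesgue_measure_rV n)
  (measurable_affine_rV a e))// => A mA.
by rewrite lebesgue_measure_rV_affine.
Qed.

(** The null set [N] of radii is carried by the substitution to the set of the
    [z] at which [phi] and [phi0] may differ, which is therefore null too. *)
Lemma integral_rescaled_kernel (R : realType) n (phi phi0 : R -> R) (N : set R)
    (g : 'rV[R]_n -> R) (x v : 'rV[R]_n) (e : R) : 0 < e ->
  measurable_fun setT phi0 -> measurable N ->
  lebesgue_measure_rV n (@enorm R n @^-1` N) = 0%E ->
  (forall r, ~ N r -> phi r = phi0 r) -> measurable_fun setT g ->
  (e ^+ n)^-1 * \int[@completed_lebesgue_measure_rV R n]_z
      (phi (enorm (x - z - v) / e) * g z) =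
  \int[lebesgue_measure_rV n]_u (phi0 (enorm u) * g (x - v - e *: u)).
Proof.
move=> e0 mphi0 mN N0 phiE mg.
pose r z := enorm (x - z - v) / e.
have mr : measurable_fun setT r.
  apply: measurable_funM => //; apply: measurableT_comp.
    exact: measurable_enorm.
  rewrite (_ : (fun _ => _) = fun z => x - v - 1 *: z).
    exact: measurable_affine_rV.
  by apply/funext => z; rewrite scale1r addrAC.
have rE u : r (x - v - e *: u) = enorm u.
  rewrite /r (_ : x - _ - v = e *: u).
    by rewrite enormZ gtr0_norm// mulrC mulrA mulVf ?mul1r// gt_eqF.
  by apply/rowP => i; rewrite !mxE; ring.
have mF : measurable_fun setT (fun z => (phi0 (r z) * g z)%:E).
  apply/measurable_EFinP; apply: measurable_funM => //.
  exact: measurableT_comp.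
have mrN : measurable (r @^-1` N) by rewrite -[X in measurable X]setTI; exact: mr.
have rN0 : lebesgue_measure_rV n (r @^-1` N) = 0%E.
  have := lebesgue_measure_rV_affine (x - v) e0 mrN.
  rewrite (_ : _ @^-1` _ = @enorm R n @^-1` N); last first.
    by apply/seteqP; split => u /=; rewrite rE.
  rewrite N0 => /esym/eqP; rewrite mule_eq0 => /orP[|/eqP//].
  by rewrite eqe gt_eqF// invr_gt0 exprn_gt0.
rewrite /Rintegral (integral_completed_lebesgue_measure_rV mF mrN rN0); last first.
  by move=> z Nz; rewrite phiE.
have -> : (\int[lebesgue_measure_rV n]_u (phi0 (enorm u) * g (x - v - e *: u))%:E =
   ((e ^+ n)^-1)%:E * \int[lebesgue_measure_rV n]_z (phi0 (r z) * g z)%:E)%E.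
  rewrite -(integral_affine_rV (x - v) e0 mF).
  by apply: eq_integral => u _; rewrite rE.
by case: (integral _ _ _) => [s| |] //=; rewrite ?gt0_muley ?gt0_muleNy ?mulr0//
  lte_fin invr_gt0 exprn_gt0.
Qed.

(** * Convergence of the mean operators *)

Theorem proposition2p1 (R : realType) (n : nat) (n_ge1 : (1 <= n)%N)
    (phi : R -> R)
    (phi_meas : lebesgue_measurable_fun `]0, +oo[ phi)
    (phi_ge0 : forall rho, 0 < rho -> 0 <= phi rho)
    (phi_int : (sphere_area R n *
       \int[@completed_lebesgue_measure R]_(rho in `]0%R, +oo[)
         (rho ^+ n.-1 * phi rho)%:E = 1)%E)
    (d : measure_display) (Omega : measurableType d) (P : probability Omega R)
    (eps : nat -> {RV P >-> R}) (eps_gt0 : forall j w, 0 < eps j w)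
    (y : nat -> {RV P >-> 'rV[R]_n})
    (Pi_cvg : vague_cvg_dirac
       (fun j => distribution P (joint_rV (eps j) (y j))) 0)
    (g : 'rV[R]_n -> R) (g_cont : continuous g) (g_bounded : bounded_fun g) :
  forall x : 'rV[R]_n,
    mean_operator phi (eps j) (y j) g x @[j --> \oo] --> (g x)%:E.
Proof.
have phi_ge0' r : `]0, +oo[%classic r -> 0 <= phi r.
  by rewrite /= in_itv/= andbT; exact: phi_ge0.
have [phi0 [N [mphi0 phi0_ge0 mN N0 phiE]]] :=
  lebesgue_measurable_fun_borel (measurable_itv `]0, +oo[) phi_meas phi_ge0'.
have phiE' r : 0 < r -> ~ N r -> phi r = phi0 r.
  by move=> r0; apply: phiE; rewrite /= in_itv/= andbT.
pose k (u : 'rV[R]_n) := phi0 (enorm u).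
have mk : measurable_fun setT k by apply: measurableT_comp => //; exact: measurable_enorm.
have k1 : (\int[lebesgue_measure_rV n]_u (k u)%:E = 1)%E.
  by rewrite (integral_normalized_kernel n_ge1 mphi0 phi0_ge0 mN N0 phiE').
have ik : (lebesgue_measure_rV n).-integrable setT (EFin \o k).
  apply/integrableP; split; first exact/measurable_EFinP.
  under eq_integral do rewrite /= ger0_norm ?phi0_ge0//.
  by rewrite k1 ltry.
(* [h] is the test function on which the convergence of the laws is used *)
move=> x; pose h := averaging (lebesgue_measure_rV n) k g x.
have ch : continuous h by exact: averaging_continuous.
have bh : bounded_fun h by exact: averaging_bounded.
have mh : measurable_fun setT (EFin \o h).
  by apply/measurable_EFinP; exact: continuous_measurable_rV.
have h0 : h 0 = g x by rewrite /h averaging0// /Rintegral k1 mul1r.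
have ih j : P.-integrable setT (EFin \o (h \o joint_rV (eps j) (y j))).
  apply: measurable_bounded_integrable => //.
  - by rewrite ltey_eq fin_num_measure.
  - by apply: measurableT_comp => //; exact/measurable_EFinP.
  - have [M [Mreal hM]] := bh; exists M; split => // B MB w _.
    exact: hM.
have meanE j : mean_operator phi (eps j) (y j) g x =
    (\int[distribution P (joint_rV (eps j) (y j))]_z h z)%:E.
  rewrite /Rintegral (integral_distribution mh (ih j)) fineK; last first.
    exact: integrable_fin_num (ih j).
  rewrite /mean_operator unlock; apply: eq_integral => w _ /=; congr EFin.
  rewrite /h /averaging /joint_rV tail_cons_rV cons_rV_head /=.
  apply: (integral_rescaled_kernel (N := N `|` `]-oo, 0])) => //.
  - exact: measurableU.
  - exact: lebesgue_measure_rV_enorm_null.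
  - move=> r /not_orP[Nr /=]; rewrite in_itv/= => /negP; rewrite -ltNge => r0.
    exact: phiE'.
  - exact: continuous_measurable_rV.
under eq_fun do rewrite meanE.
rewrite -h0; apply: cvg_EFin; first exact: nearW.
exact: Pi_cvg.
Qed.
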